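(* Let $h_1,h_2\in\mathbb{C}$, $q=e^{h_1}$, $p=e^{h_2}$, $pq\neq\pm1$, $h=\frac{h_1+h_2}{2}$. Let $T=\begin{pmatrix} a&\beta\\ \gamma&d\end{pmatrix}\in GL_{p,q}(1|1)$ and let $M=\begin{pmatrix} x&\mu\\ \nu&y\end{pmatrix}=\frac1h\ln T$ (so that $T=e^{hM}$), where the logarithms of $a$ and $d$ are assumed to exist and the denominators appearing in $f_q,f_p,g$ (see context) are non-zero. Then the matrix elements of $M$ are expressed in terms of those of $T$ by $$x=\frac1h\left\{\ln a+f_q(a,d,p)\,\beta\gamma\right\},\qquad \mu=\frac1h\,g(a,q^{-1}d)\,\beta,$$ $$y=\frac1h\left\{\ln d+f_p(d,a,q)\,\gamma\beta\right\},\qquad \nu=\frac1h\,g(d,p^{-1}a)\,\gamma .$$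
   Context: Setting: $a,\beta,\gamma,d$ are elements of a unital associative $\mathbb{C}$-algebra. The matrix $T=\begin{pmatrix} a&\beta\\ \gamma&d\end{pmatrix}$ is said to belong to $GL_{p,q}(1|1)$ if $a\beta=q\beta a$, $d\beta=q\beta d$, $a\gamma=p\gamma a$, $d\gamma=p\gamma d$, $\beta\gamma+pq^{-1}\gamma\beta=0$, $\beta^2=0=\gamma^2$, $ad-da=(p-q^{-1})\gamma\beta$; $a$ and $d$ are assumed invertible. The logarithm of $T$ is defined by the series $\ln T=\sum_{n\ge1}\frac{(-1)^{n+1}}{n}(T-I)^n$ (assumed to make sense), and similarly for $\ln a$, $\ln d$, $\ln(q^{-1}d)$, etc.; here $\ln(q^{-1}d)=\ln d-h_1$, $\ln(p^{-1}a)=\ln a-h_2$, $\ln(p^{-1}q^{-1}a)=\ln a-h_1-h_2$, $\ln(p^{-1}q^{-1}d)=\ln d-h_1-h_2$. In any product with $\beta$ or $\gamma$, $a$ and $d$ behave as commuting quantities (e.g. $ad\beta=da\beta$), so functions of $a,d$ multiplied by $\beta$ or $\gamma$ need no ordering of $a$ and $d$. With this convention, $$f_q(a,d,p)\,\beta\gamma=\frac{q^2}{q-p^{-1}}\left(\frac{\ln a}{a(qa-d)}-\frac{\ln(p^{-1}q^{-1}a)}{a(p^{-1}a-d)}\right)\beta\gamma+q^2\,\frac{\ln(q^{-1}d)}{(p^{-1}a-d)(qa-d)}\,\beta\gamma,$$ and $f_p(d,a,q)\gamma\beta$ is obtained from it by exchanging $a\leftrightarrow d$, $p\leftrightarrow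 q$, $\beta\leftrightarrow\gamma$: $$f_p(d,a,q)\,\gamma\beta=\frac{p^2}{p-q^{-1}}\left(\frac{\ln d}{d(pd-a)}-\frac{\ln(p^{-1}q^{-1}d)}{d(q^{-1}d-a)}\right)\gamma\beta+p^2\,\frac{\ln(p^{-1}a)}{(q^{-1}d-a)(pd-a)}\,\gamma\beta;$$ $$g(a,q^{-1}d)\,\beta=\frac{\ln a-\ln(q^{-1}d)}{a-q^{-1}d}\,\beta,\qquad g(d,p^{-1}a)\,\gamma=\frac{\ln d-\ln(p^{-1}a)}{d-p^{-1}a}\,\gamma .$$ *)

(* Defs.v *)
From HB Require Import structures.
From mathcomp Require Import all_boot all_order all_algebra.
From mathcomp Require Import all_classical all_reals all_analysis.
From mathcomp Require Import complex.

Set Implicit Arguments.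
Unset Strict Implicit.
Unset Printing Implicit Defensive.

Import Order.TTheory GRing.Theory Num.Theory.
Local Open Scope classical_set_scope.
Local Open Scope ring_scope.

HB.mixin Record isSepContinuousMul (K : numFieldType) A
    & GRing.UnitAlgebra K A & TopologicalLmodule K A := {
  mull_continuous : forall u : A, continuous (fun v : A => u * v) ;
  mulr_continuous : forall u : A, continuous (fun v : A => v * u) }.

(* Topological unital associative K-algebras; multiplication is only required
   to be separately continuous. *)
#[short(type="topAlgType")]
HB.structure Definition TopAlgebra (K : numFieldType) :=
  {A of GRing.UnitAlgebra K A & TopologicalLmodule K A
      & isSepContinuousMul K A}.

Definition cexp (R : realType) (z : R[i]) : R[i] :=
  Complex (expR (complex.Re z) * cos (complex.Im z))
          (expR (complex.Re z) * sin (complex.Im z)).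

(* Entrywise scaling: the library only makes 'M[A]_2 a left module over A. *)
Definition scalemx2 (K : pzRingType) (A : lmodType K) (c : K) (T : 'M[A]_2) :
  'M[A]_2 := map_mx (fun u => c *: u) T.

Section GLpq.
Context {R : realType} {A : topAlgType R[i]}.
Implicit Types (u v a be ga d : A) (T : 'M[A]_2) (p q : R[i]).

Definition mx2 a be ga d : 'M[A]_2 :=
  \matrix_(i, j) if i == 0 then (if j == 0 then a else be)
                 else (if j == 0 then ga else d).

Record GLpq p q T : Prop := {
  GLpq_ab : T 0 0 * T 0 1 = q *: (T 0 1 * T 0 0) ;
  GLpq_db : T 1 1 * T 0 1 = q *: (T 0 1 * T 1 1) ;
  GLpq_ac : T 0 0 * T 1 0 = p *: (T 1 0 * T 0 0) ;
  GLpq_dc : T 1 1 * T 1 0 = p *: (T 1 0 * T 1 1) ;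
  GLpq_bc : T 0 1 * T 1 0 + (p * q^-1) *: (T 1 0 * T 0 1) = 0 ;
  GLpq_bb : T 0 1 ^+ 2 = 0 ;
  GLpq_cc : T 1 0 ^+ 2 = 0 ;
  GLpq_ad : T 0 0 * T 1 1 - T 1 1 * T 0 0
              = (p - q^-1) *: (T 1 0 * T 0 1) ;
  GLpq_a_unit : T 0 0 \is a GRing.unit ;
  GLpq_d_unit : T 1 1 \is a GRing.unit }.

Definition ln_coef (n : nat) : R[i] := (-1) ^+ n.+1 / n%:R.

Definition ln_psum u (N : nat) : A :=
  \sum_(1 <= n < N.+1) ln_coef n *: (u - 1) ^+ n.
Definition is_ln u (l : A) : Prop := ln_psum u @ \oo --> l.
Definition has_ln u : Prop := exists l : A, is_ln u l.
(* 0 if the series does not converge. *)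
Definition alg_ln u : A := xget 0 [set l : A | is_ln u l].

Definition mx_ln_psum T (N : nat) : 'M[A]_2 :=
  \sum_(1 <= n < N.+1) scalemx2 (ln_coef n) ((T - 1) ^+ n).
Definition is_mx_ln T (L : 'M[A]_2) : Prop := mx_ln_psum T @ \oo --> L.
Definition has_mx_ln T : Prop := exists L : 'M[A]_2, is_mx_ln T L.
(* 0 if the series does not converge. *)
Definition mx_ln T : 'M[A]_2 := xget 0 [set L : 'M[A]_2 | is_mx_ln T L].

(* fun_f q a d p is f_q(a,d,p) and fun_f p d a q is f_p(d,a,q). A fraction
   x / y is x * y^-1 in A. Since a and d commute in front of be and of
   ga, another order of the factors would give the same products
   fun_f q a d p * (be * ga), fun_f p d a q * (ga * be), fun_g _ _ * be and
   fun_g _ _ * ga. *)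
Definition fun_f q a d p : A :=
  (q ^+ 2 / (q - p^-1)) *:
     (alg_ln a / (a * (q *: a - d))
      - alg_ln ((p^-1 * q^-1) *: a) / (a * (p^-1 *: a - d)))
  + q ^+ 2 *: (alg_ln (q^-1 *: d) / ((p^-1 *: a - d) * (q *: a - d))).

Definition fun_g u v : A := (alg_ln u - alg_ln v) / (u - v).

End GLpq.

(* Main.v *)
(* Let V be the right annihilator of be ga. It contains be and ga, and it is
   stable under a, d and the inverses of their linear combinations, since be ga
   commutes with a and d up to a nonzero scalar. Moreover a and d commute on V,
   since [a, d] is a multiple of ga be, hence of be ga. On V the entries of
   (T - 1)^n are thus divided differences of X |-> (X - 1)^n, for instance
     (a - q^-1 d) ((T - 1)^n)_01 = ((a - 1)^n - (q^-1 d - 1)^n) be,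
   and summing the logarithmic series gives x and mu. The relations are
   invariant under a <-> d, p <-> q, be <-> ga, which gives y and nu. *)
Require Import Defs.
From HB Require Import structures.
From mathcomp Require Import all_boot all_order all_algebra.
From mathcomp Require Import all_classical all_reals all_analysis.
From mathcomp Require Import complex ring.

Import Order.TTheory GRing.Theory Num.Theory.
Local Open Scope classical_set_scope.
Local Open Scope ring_scope.

(** * Commutation and stability on a set of vectors, and right annihilators *)

Definition comm_on (A : pzRingType) (V : A -> Prop) (u v : A) : Prop :=
  forall w, V w -> u * (v * w) = v * (u * w).

Definition stab_on (A : pzRingType) (V : A -> Prop) (u : A) : Prop :=
  forall w, V w -> V (u * w).

Definition ann_by (A : pzRingType) (g w : A) : Prop := g * w = 0.

Lemma intertwineX (A : pzRingType) (u v w : A) (n : nat) :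
  u * v = w * u -> u * v ^+ n = w ^+ n * u.
Proof.
move=> uv; elim: n => [|n IHn]; first by rewrite !expr0 mulr1 mul1r.
by rewrite exprS mulrA uv -mulrA IHn mulrA -exprS.
Qed.

(** Induction step shared by the divided differences below: for u = x^n and v = y^n the right-hand
    side is x^(n+1) - y^(n+1). *)
Lemma mulrB_telescope (A : pzRingType) (x y u v : A) :
  x * (u - v) + (x - y) * v = x * u - y * v.
Proof. by rewrite mulrBr mulrBl addrA subrK. Qed.

Section CommOn.
Context {K : fieldType} {A : unitAlgType K} {V : A -> Prop}.
Implicit Types u v w : A.

Lemma comm_onC u v : comm_on A V u v -> comm_on A V v u.
Proof. by move=> uv w /uv. Qed.

Lemma comm_on_lin u v1 v2 (k1 k2 : K) : comm_on A V u v1 -> comm_on A V u v2 ->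
  comm_on A V u (k1 *: v1 + k2 *: v2).
Proof.
move=> uv1 uv2 w Vw.
by rewrite !mulrDl mulrDr -!scalerAl -!scalerAr uv1 // uv2.
Qed.

Lemma comm_on_sub1 u v : comm_on A V u v -> comm_on A V u (v - 1).
Proof.
by move=> uv w Vw; rewrite !mulrBl mulrBr !mul1r uv.
Qed.

Lemma comm_onX u v n : stab_on A V v -> comm_on A V u v ->
  comm_on A V u (v ^+ n).
Proof.
move=> sv uv; elim: n => [|n IHn] w Vw; first by rewrite expr0 !mul1r.
by rewrite exprSr -!mulrA IHn ?uv //; apply: sv.
Qed.

(** Cancelling [v] on the left reduces the claim to commutation at the vector [v^-1 * w], which must
    therefore lie in [V]. *)
Lemma comm_onV u v : v \is a GRing.unit -> stab_on A V v^-1 ->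
  comm_on A V u v -> comm_on A V u v^-1.
Proof.
move=> vU sv uv w Vw; apply: (mulrI vU).
by rewrite -uv; [rewrite !mulVKr | exact: sv].
Qed.
End CommOn.

Lemma ann_byD (A : pzRingType) (g u v : A) :
  ann_by A g u -> ann_by A g v -> ann_by A g (u + v).
Proof. by rewrite /ann_by mulrDr => -> ->; rewrite addr0. Qed.

Lemma ann_by_mulr (A : pzRingType) (g u v : A) :
  ann_by A g u -> ann_by A g (u * v).
Proof. by rewrite /ann_by mulrA => ->; rewrite mul0r. Qed.

Section AnnBy.
Context {K : fieldType} {A : unitAlgType K} {g : A}.
Implicit Types u v w : A.

Lemma stab_ann_by u (k : K) : g * u = k *: (u * g) -> stab_on A (ann_by A g) u.
Proof.
by move=> gu w gw; rewrite /ann_by mulrA gu -scalerAl -mulrA gw mulr0 scaler0.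
Qed.

(** Multiplying g u^-1 w by k u on the left gives g w = 0, and both k and u can be cancelled. *)
Lemma stab_ann_byV u (k : K) : u \is a GRing.unit -> k != 0 ->
  g * u = k *: (u * g) -> stab_on A (ann_by A g) u^-1.
Proof.
move=> uU k0 gu w gw; apply: (mulrI uU); apply: (scalerI k0).
by rewrite mulr0 scaler0 [u * _]mulrA scalerAl -gu -mulrA mulVKr.
Qed.

Lemma stab_ann_by_sub1 u : stab_on A (ann_by A g) u ->
  stab_on A (ann_by A g) (u - 1).
Proof.
by move=> su w gw; rewrite /ann_by mulrBl mul1r mulrBr gw su // subrr.
Qed.
End AnnBy.

(** * Series with the coefficients of the logarithm *)

Section LogSeries.
Context {R : realType} {A : topAlgType R[i]}.
Implicit Types (u l : A) (s t : nat -> A).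

(** The sequence is arbitrary, so that powers of an element, entries of matrix powers and one-sided
    multiples of either are summed in the same way. *)
Definition log_psum (s : nat -> A) (N : nat) : A :=
  \sum_(1 <= n < N.+1) ln_coef n *: s n.

Definition log_cvg (s : nat -> A) (l : A) : Prop := log_psum s @ \oo --> l.

Lemma log_cvgMl u s l : log_cvg s l -> log_cvg (fun n => u * s n) (u * l).
Proof.
move=> sl; rewrite /log_cvg.
have -> : log_psum (fun n => u * s n) = (fun N => u * log_psum s N).
  apply/funext => N; rewrite /log_psum mulr_sumr.
  by apply: eq_bigr => n _; rewrite scalerAr.
exact: (continuous_cvg _ (mull_continuous u l) sl).
Qed.

Lemma log_cvgMr u s l : log_cvg s l -> log_cvg (fun n => s n * u) (l * u).
Proof.
move=> sl; rewrite /log_cvg.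
have -> : log_psum (fun n => s n * u) = (fun N => log_psum s N * u).
  apply/funext => N; rewrite /log_psum mulr_suml.
  by apply: eq_bigr => n _; rewrite scalerAl.
exact: (continuous_cvg _ (mulr_continuous u l) sl).
Qed.

Lemma log_cvgB s t l m :
  log_cvg s l -> log_cvg t m -> log_cvg (fun n => s n - t n) (l - m).
Proof.
move=> sl tm; rewrite /log_cvg.
have -> : log_psum (fun n => s n - t n) =
    (fun N => log_psum s N - log_psum t N).
  apply/funext => N; rewrite /log_psum -sumrB.
  by apply: eq_bigr => n _; rewrite scalerBr.
apply: (@continuous2_cvg nat A A A \oo _ (log_psum s) (log_psum t)
  (fun x y : A => x - y)) => //.
exact: (@sub_continuous A (l, m)).
Qed.

(** Turns an identity valid for every exponent n into an identity between logarithms. *)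
Lemma log_cvg_unique s t l m : hausdorff_space A -> log_cvg s l ->
  log_cvg t m -> (forall n, s n = t n) -> l = m.
Proof.
move=> hA sl tm /funext st; move: tm; rewrite -st => tm.
exact: (cvg_unique hA sl tm).
Qed.

Lemma alg_lnP u : has_ln u -> is_ln u (alg_ln u).
Proof. exact: xgetPex. Qed.

(** For w in [V], the series of v u' w and of u' v w, with u' running through the powers of u - 1,
    agree term by term; their sums are v l w and l v w. *)
Lemma comm_on_ln (V : A -> Prop) u v l : hausdorff_space A ->
  stab_on A V (u - 1) -> comm_on A V v u -> is_ln u l ->
  comm_on A V v l.
Proof.
move=> hA su vu ul w Vw.
apply: (log_cvg_unique _ _ _ _ hA (log_cvgMl v _ _ (log_cvgMr w _ _ ul))
  (log_cvgMr (v * w) _ _ ul)).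
move=> n; apply: (comm_onX _ _ _ su) => //; exact: comm_on_sub1.
Qed.

Lemma mx_log_cvg (T L : 'M[A]_2) (i j : 'I_2) : is_mx_ln T L ->
  log_cvg (fun n => ((T - 1) ^+ n) i j) (L i j).
Proof.
move=> TL; rewrite /log_cvg.
have -> : log_psum (fun n => ((T - 1) ^+ n) i j) =
    (fun N => mx_ln_psum T N i j).
  apply/funext => N; rewrite /log_psum /mx_ln_psum summxE.
  by apply: eq_bigr => n _; rewrite mxE.
have c : {for L, continuous (fun M : 'M[A]_2 => M i j)}.
  (* Neighbourhoods of a matrix are generated by families of neighbourhoods of its entries; only the
     entry (i, j) is constrained here. *)
  move=> B /= nB; exists (fun k m => if (k == i) && (m == j) then B else setT).
    move=> k m; case: ifP => [/andP[/eqP -> /eqP ->] //|_]; exact: filterT.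
  by move=> M /(_ i j); rewrite !eqxx.
exact: (continuous_cvg _ c TL).
Qed.

End LogSeries.

(** * Exchange relations and the annihilator of [be * ga] *)

Section Powers.
Context {R : realType} {A : topAlgType R[i]} {p q : R[i]} {a be ga d : A}.
Hypotheses (p0 : p != 0) (q0 : q != 0) (pq1 : p * q != 1).
Hypotheses (ab : a * be = q *: (be * a)) (db : d * be = q *: (be * d))
  (ac : a * ga = p *: (ga * a)) (dc : d * ga = p *: (ga * d))
  (bc : be * ga + (p * q^-1) *: (ga * be) = 0)
  (bb : be ^+ 2 = 0) (cc : ga ^+ 2 = 0)
  (ad : a * d - d * a = (p - q^-1) *: (ga * be)).

Let V := ann_by A (be * ga).

Lemma be_lin (k1 k2 : R[i]) :
  be * (k1 *: a + k2 *: d) = ((q^-1 * k1) *: a + (q^-1 * k2) *: d) * be.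
Proof.
rewrite mulrDl -!scalerAl ab db !scalerA mulrDr -!scalerAr.
by congr (_ *: _ + _ *: _); field.
Qed.

Lemma ga_lin (k1 k2 : R[i]) :
  ga * (k1 *: a + k2 *: d) = ((p^-1 * k1) *: a + (p^-1 * k2) *: d) * ga.
Proof.
rewrite mulrDl -!scalerAl ac dc !scalerA mulrDr -!scalerAr.
by congr (_ *: _ + _ *: _); field.
Qed.

(** Passing [ga] costs p^-1 and passing [be] costs q^-1, for [a] and [d] alike; hence one scalar
    serves all their linear combinations. *)
Lemma bega_lin (k1 k2 : R[i]) : be * ga * (k1 *: a + k2 *: d) =
  (p^-1 * q^-1) *: ((k1 *: a + k2 *: d) * (be * ga)).
Proof.
rewrite -mulrA ga_lin mulrA be_lin -mulrA scalerAl scalerDr !scalerA.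
by congr ((_ *: _ + _ *: _) * _); field; rewrite q0 p0.
Qed.

Lemma stab_lin (k1 k2 : R[i]) : stab_on A V (k1 *: a + k2 *: d).
Proof. exact: stab_ann_by (bega_lin k1 k2). Qed.

Lemma stab_linV (k1 k2 : R[i]) : k1 *: a + k2 *: d \is a GRing.unit ->
  stab_on A V (k1 *: a + k2 *: d)^-1.
Proof.
move=> U; apply: (stab_ann_byV _ _ U _ (bega_lin k1 k2)).
by rewrite mulf_neq0 ?invr_neq0.
Qed.

Lemma gabe : ga * be = - (p^-1 * q) *: (be * ga).
Proof.
move/eqP: bc; rewrite addr_eq0 => /eqP ->.
have e : p^-1 * q * (p * q^-1) = 1 by field; rewrite p0 q0.
by rewrite scalerN scaleNr opprK scalerA e scale1r.
Qed.

Lemma ann_gabe w : V w -> ga * be * w = 0.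
Proof. by move=> Vw; rewrite gabe -scalerAl Vw scaler0. Qed.

(** The product be ga be is a multiple of be be ga, which vanishes with the square of [be]. *)
Lemma ann_be u : V (be * u).
Proof.
by apply: ann_by_mulr; rewrite /ann_by -mulrA gabe -scalerAr mulrA -expr2 bb
  mul0r scaler0.
Qed.

Lemma ann_ga u : V (ga * u).
Proof. by apply: ann_by_mulr; rewrite /ann_by -mulrA -expr2 cc mulr0. Qed.

Lemma comm_on_ad : comm_on A V a d.
Proof.
move=> w Vw; apply/eqP; rewrite -subr_eq0 !mulrA -mulrBl ad -scalerAl.
by rewrite ann_gabe // scaler0.
Qed.

Lemma comm_on_lin2 (k1 k2 l1 l2 : R[i]) :
  comm_on A V (k1 *: a + k2 *: d) (l1 *: a + l2 *: d).
Proof.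
by apply: comm_on_lin; apply: comm_onC; apply: comm_on_lin => //;
  [|apply: comm_onC]; apply: comm_on_ad.
Qed.

Lemma a_lin : a = 1 *: a + 0 *: d.
Proof. by rewrite scale1r scale0r addr0. Qed.

Lemma d_lin : d = 0 *: a + 1 *: d.
Proof. by rewrite scale1r scale0r add0r. Qed.

Lemma stab_a : stab_on A V a.
Proof. by rewrite a_lin; apply: stab_lin. Qed.

Lemma stab_d : stab_on A V d.
Proof. by rewrite d_lin; apply: stab_lin. Qed.

Lemma be_d1 : be * (d - 1) = (q^-1 *: d - 1) * be.
Proof.
by rewrite mulrBr mulrBl mulr1 mul1r -scalerAl db scalerA mulVf ?scale1r.
Qed.

Lemma ga_a1 : ga * (a - 1) = (p^-1 *: a - 1) * ga.
Proof.
by rewrite mulrBr mulrBl mulr1 mul1r -scalerAl ac scalerA mulVf ?scale1r.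
Qed.

Lemma be_pa1 : be * (p^-1 *: a - 1) = ((p^-1 * q^-1) *: a - 1) * be.
Proof.
rewrite mulrBr mulrBl mulr1 mul1r -scalerAl ab scalerA -scalerAr.
by rewrite -mulrA mulVf ?mulr1.
Qed.

(* The entries of [(T - 1) ^+ n]. *)
Context {s00 s01 s10 s11 : nat -> A}.
Hypotheses (s00_0 : s00 0 = 1) (s01_0 : s01 0 = 0)
  (s10_0 : s10 0 = 0) (s11_0 : s11 0 = 1).
Hypotheses
  (s00_S : forall n, s00 n.+1 = (a - 1) * s00 n + be * s10 n)
  (s01_S : forall n, s01 n.+1 = (a - 1) * s01 n + be * s11 n)
  (s10_S : forall n, s10 n.+1 = ga * s00 n + (d - 1) * s10 n)
  (s11_S : forall n, s11 n.+1 = ga * s01 n + (d - 1) * s11 n).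

(** * Closed forms for the entries of the powers of T - 1 *)

Lemma ann_s01 n : V (s01 n).
Proof.
elim: n => [|n IHn]; first by rewrite s01_0 /V /ann_by mulr0.
rewrite s01_S; apply: ann_byD; last exact: ann_be.
by apply: stab_ann_by_sub1 => //; apply: stab_a.
Qed.

Lemma ann_s10 n : V (s10 n).
Proof.
elim: n => [|n IHn]; first by rewrite s10_0 /V /ann_by mulr0.
rewrite s10_S; apply: ann_byD; first exact: ann_ga.
by apply: stab_ann_by_sub1 => //; apply: stab_d.
Qed.

(** In the recurrence the term be ga s01 dies because [s01 n] lies in [V]. What remains is
    multiplication by d - 1, and moving [be] through it replaces d by q^-1 d. *)
Lemma be_s11 n : be * s11 n = (q^-1 *: d - 1) ^+ n * be.
Proof.
elim: n => [|n IHn]; first by rewrite s11_0 expr0 mul1r mulr1.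
rewrite s11_S mulrDr !mulrA [be * ga * _]ann_s01 add0r be_d1 -mulrA IHn.
by rewrite mulrA -exprS.
Qed.

Lemma ga_s00 n : ga * s00 n = (p^-1 *: a - 1) ^+ n * ga.
Proof.
elim: n => [|n IHn]; first by rewrite s00_0 expr0 mul1r mulr1.
rewrite s00_S mulrDr !mulrA (ann_gabe _ (ann_s10 n)) addr0 ga_a1 -mulrA IHn.
by rewrite mulrA -exprS.
Qed.

Lemma be_ga_s00 n :
  be * (ga * s00 n) = ((p^-1 * q^-1) *: a - 1) ^+ n * (be * ga).
Proof. by rewrite ga_s00 mulrA (intertwineX _ _ _ _ _ be_pa1) mulrA. Qed.

Lemma s01E n : (a - q^-1 *: d) * s01 n =
  ((a - 1) ^+ n - (q^-1 *: d - 1) ^+ n) * be.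
Proof.
elim: n => [|n IHn]; first by rewrite s01_0 !expr0 subrr mul0r mulr0.
have cA : comm_on A V (a - q^-1 *: d) (a - 1).
  apply: comm_on_sub1; rewrite {2}a_lin -scaleNr -{1}[a]scale1r.
  exact: comm_on_lin2.
rewrite s01_S be_s11 mulrDr cA; last exact: ann_s01.
rewrite IHn.
have -> : a - q^-1 *: d = (a - 1) - (q^-1 *: d - 1).
  by rewrite opprB addrA subrK.
by rewrite !exprS !mulrA -mulrDl mulrB_telescope.
Qed.

(** The entry [s10] feeds [s00] only through [be * s10 n]. Carrying [be] to the right shifts the
    nodes d and p^-1 a of the divided difference to q^-1 d and p^-1 q^-1 a. *)
Lemma be_s10E n : (q^-1 *: d - (p^-1 * q^-1) *: a) * (be * s10 n) =
  ((q^-1 *: d - 1) ^+ n - ((p^-1 * q^-1) *: a - 1) ^+ n) * (be * ga).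
Proof.
elim: n => [|n IHn]; first by rewrite s10_0 !expr0 subrr mul0r !mulr0.
have cD : comm_on A V (q^-1 *: d - (p^-1 * q^-1) *: a) (q^-1 *: d - 1).
  apply: comm_on_sub1; rewrite -scaleNr addrC.
  rewrite -[X in comm_on _ _ _ X]add0r -(scale0r a).
  exact: comm_on_lin2.
rewrite s10_S mulrDr be_ga_s00 [be * (_ * s10 n)]mulrA be_d1 -mulrA mulrDr.
rewrite cD; last exact: ann_be.
rewrite IHn.
have -> : q^-1 *: d - (p^-1 * q^-1) *: a =
    (q^-1 *: d - 1) - ((p^-1 * q^-1) *: a - 1) by rewrite opprB addrA subrK.
by rewrite !exprS !mulrA -!mulrDl addrC mulrB_telescope.
Qed.

(** This is the recursion f[x0,x1,x2] (x0 - x2) = f[x0,x1] - f[x1,x2] for f = (X - 1)^n at the nodes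
    a, q^-1 d, p^-1 q^-1 a: the two terms on the right are first divided differences applied to
    [be * ga]. *)
Lemma s00E n : (a - (p^-1 * q^-1) *: a) * (s00 n - (a - 1) ^+ n) =
  s01 n * ga - be * s10 n.
Proof.
elim: n => [|n IHn].
  by rewrite s00_0 s01_0 s10_0 expr0 subrr mul0r !mulr0 subrr.
have ca : (a - (p^-1 * q^-1) *: a) * (a - 1) =
    (a - 1) * (a - (p^-1 * q^-1) *: a).
  rewrite -{1 5}[a]scale1r -scalerBl -scalerAl -scalerAr.
  by rewrite mulrBr mulrBl mulr1 mul1r.
have e1 : s01 n.+1 * ga =
    (a - 1) * (s01 n * ga) + (q^-1 *: d - 1) ^+ n * (be * ga).
  by rewrite s01_S be_s11 mulrDl !mulrA.
have e2 : be * s10 n.+1 = ((p^-1 * q^-1) *: a - 1) ^+ n * (be * ga)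
    + (q^-1 *: d - 1) * (be * s10 n).
  by rewrite s10_S mulrDr be_ga_s00 [be * (_ * s10 n)]mulrA be_d1 -mulrA.
have := be_s10E n; set X := be * s10 n in e2 *; set Y := s01 n * ga in IHn e1 *.
set w := be * ga in e1 e2 *; rewrite e1 e2 s00_S exprS addrAC -mulrBr mulrDr.
rewrite [X in X + _ = _]mulrA ca -mulrA IHn -/X.
set D1 := (q^-1 *: d - 1) ^+ n; set A3 := (_ *: a - 1) ^+ n.
rewrite [(D1 - A3) * w]mulrBl => e3.
(* The first divided difference trades the power of q^-1 d for that of p^-1 q^-1 a, so that the
   powers cancel and only multiples of [X] and [Y] are left to compare. *)
have -> : D1 * w = A3 * w + (q^-1 *: d - (p^-1 * q^-1) *: a) * X.
  by rewrite e3 addrC subrK.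
rewrite opprD addrA [_ + (A3 * w + _)]addrCA [A3 * w + _]addrC addrK mulrBr.
rewrite -!addrA; congr (_ + _).
rewrite -!mulNr -!mulrDl; congr (_ * _).
by rewrite !opprB addrA subrK [RHS]addrC addrA subrK.
Qed.

(** * Linear combinations of [a] and [d], their inverses and their logarithms *)

Definition lin_ad (u : A) : Prop := exists k1 k2 : R[i], u = k1 *: a + k2 *: d.

Lemma lin_adB (k1 k2 : R[i]) : lin_ad (k1 *: a - k2 *: d).
Proof. by exists k1, (- k2); rewrite scaleNr. Qed.

Lemma lin_ada (k : R[i]) : lin_ad (k *: a).
Proof. by exists k, 0; rewrite scale0r addr0. Qed.

Lemma lin_add (k : R[i]) : lin_ad (k *: d).
Proof. by exists 0, k; rewrite scale0r add0r. Qed.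

Hypothesis hA : hausdorff_space A.

Lemma comm_on_lin_ln u v l : lin_ad u -> lin_ad v -> is_ln v l ->
  comm_on A V u l.
Proof.
move=> [k1 [k2 ->]] [l1 [l2 ->]]; apply: comm_on_ln => //.
  by apply: stab_ann_by_sub1; exact: stab_lin.
exact: comm_on_lin2.
Qed.

Lemma lin_unit_stab u : lin_ad u -> u \is a GRing.unit -> stab_on A V u^-1.
Proof. by move=> [k1 [k2 ->]]; exact: stab_linV. Qed.

Lemma comm_on_ln_lin u v l : lin_ad u -> u \is a GRing.unit ->
  lin_ad v -> is_ln v l -> comm_on A V l u^-1.
Proof.
move=> lu uU lv vl; apply: comm_onV => //; first exact: lin_unit_stab.
by apply: comm_onC; exact: comm_on_lin_ln vl.
Qed.

Lemma comm_on_lin_lin u v : lin_ad u -> lin_ad v -> comm_on A V u v.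
Proof. by move=> [k1 [k2 ->]] [l1 [l2 ->]]; exact: comm_on_lin2. Qed.

(** Division by u first puts u^-1 to the left of the logarithms; since w is in [V] it can be moved
    to their right, where the fractions of [fun_f] and [fun_g] have it. *)
Lemma div_lin_ln u v1 v2 l1 l2 w x : V w ->
    lin_ad u -> u \is a GRing.unit ->
    lin_ad v1 -> is_ln v1 l1 -> lin_ad v2 -> is_ln v2 l2 ->
  u * x = (l1 - l2) * w -> x = (l1 - l2) * (u^-1 * w).
Proof.
move=> Vw lu uU lv1 vl1 lv2 vl2 ux.
rewrite mulrBl (comm_on_ln_lin _ _ _ lu uU lv1 vl1) //.
rewrite (comm_on_ln_lin _ _ _ lu uU lv2 vl2) // -mulrBr -mulrBl -ux.
by rewrite mulKr.
Qed.

(** On [V] the factor u commutes with the logarithm and with b^-1, hence reaches its inverse. *)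
Lemma lin_ln_cancel u b v l w : V w -> lin_ad u -> u \is a GRing.unit ->
  lin_ad b -> b \is a GRing.unit -> lin_ad v -> is_ln v l ->
  u * (l * (b^-1 * (u^-1 * w))) = l * (b^-1 * w).
Proof.
move=> Vw lu uU lb bU lv vl.
have Vuw := lin_unit_stab _ lu uU _ Vw.
rewrite (comm_on_lin_ln _ _ _ lu lv vl); last exact: (lin_unit_stab _ lb bU).
have cub : comm_on A V u b^-1.
  apply: comm_onV => //; first exact: lin_unit_stab.
  exact: comm_on_lin_lin.
by rewrite cub // mulVKr.
Qed.

(** * Summation of the series: the entries of the logarithm *)

Context {L00 L01 L10 la lqd lpqa : A}.
Hypotheses (l00 : log_cvg s00 L00) (l01 : log_cvg s01 L01)
  (l10 : log_cvg s10 L10).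
Hypotheses (aln : is_ln a la) (qdln : is_ln (q^-1 *: d) lqd)
  (pqaln : is_ln ((p^-1 * q^-1) *: a) lpqa).
Hypotheses (aU : a \is a GRing.unit) (Uqad : (q *: a - d) \is a GRing.unit)
  (Upad : (p^-1 *: a - d) \is a GRing.unit).

Let lin_a : lin_ad a. Proof. by rewrite -[a]scale1r; exact: lin_ada. Qed.
Let lin_b1 : lin_ad (q *: a - d).
Proof. by rewrite -[d]scale1r; exact: lin_adB. Qed.
Let lin_b2 : lin_ad (p^-1 *: a - d).
Proof. by rewrite -[d]scale1r; exact: lin_adB. Qed.
Let lin_qd : lin_ad (q^-1 *: d). Proof. exact: lin_add. Qed.
Let lin_pqa : lin_ad ((p^-1 * q^-1) *: a). Proof. exact: lin_ada. Qed.

(** The differences of consecutive nodes are scalar multiples of the denominators of [fun_f]; the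
    next few facts transfer inverses and units between the two. *)
Let b1E : a - q^-1 *: d = q^-1 *: (q *: a - d).
Proof. by rewrite scalerBr scalerA mulVf // scale1r. Qed.

Let b2E : q^-1 *: d - (p^-1 * q^-1) *: a = - q^-1 *: (p^-1 *: a - d).
Proof. by rewrite scaleNr scalerBr scalerA opprB [q^-1 * _]mulrC. Qed.

Let b1V : (a - q^-1 *: d)^-1 = q *: (q *: a - d)^-1.
Proof. by rewrite b1E invrZ ?invrK // unitfE invr_eq0. Qed.

Let b2V : (q^-1 *: d - (p^-1 * q^-1) *: a)^-1 = - q *: (p^-1 *: a - d)^-1.
Proof. by rewrite b2E invrZ ?invrN ?invrK // unitfE oppr_eq0 invr_eq0. Qed.

Let b1U : a - q^-1 *: d \is a GRing.unit.
Proof. by rewrite b1E scaler_unit // unitfE invr_eq0. Qed.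

Let b2U : q^-1 *: d - (p^-1 * q^-1) *: a \is a GRing.unit.
Proof. by rewrite b2E scaler_unit // unitfE oppr_eq0 invr_eq0. Qed.

Lemma log_entry01 : L01 = (la - lqd) * ((a - q^-1 *: d)^-1 * be).
Proof.
apply: (div_lin_ln _ _ _ _ _ _ _ _ _ b1U lin_a aln lin_qd qdln).
- by rewrite -[be]mulr1; exact: ann_be.
- by rewrite -{1}[a]scale1r; exact: lin_adB.
apply: (log_cvg_unique _ _ _ _ hA (log_cvgMl _ _ _ l01)
  (log_cvgMr be _ _ (log_cvgB _ _ _ _ aln qdln))) => n.
exact: s01E.
Qed.

Lemma log_entry10 : be * L10 =
  (lqd - lpqa) * ((q^-1 *: d - (p^-1 * q^-1) *: a)^-1 * (be * ga)).
Proof.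
apply: (div_lin_ln _ _ _ _ _ _ _ _ _ b2U lin_qd qdln lin_pqa pqaln).
- exact: ann_be.
- by exists (- (p^-1 * q^-1)), q^-1; rewrite addrC scaleNr.
apply: (log_cvg_unique _ _ _ _ hA
  (log_cvgMl _ _ _ (log_cvgMl be _ _ l10))
  (log_cvgMr (be * ga) _ _ (log_cvgB _ _ _ _ qdln pqaln))) => n.
exact: be_s10E.
Qed.

Lemma log_entry00 : L00 = la +
  ((q ^+ 2 / (q - p^-1)) *: (la / (a * (q *: a - d)) -
      lpqa / (a * (p^-1 *: a - d)))
   + q ^+ 2 *: (lqd / ((p^-1 *: a - d) * (q *: a - d)))) * (be * ga).
Proof.
have Vw : V (be * ga) by exact: ann_be.
apply/eqP; rewrite addrC -subr_eq; apply/eqP.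
have qp : q - p^-1 != 0.
  by rewrite subr_eq0; apply: contra pq1 => /eqP ->; rewrite divff.
have k0 : 1 - p^-1 * q^-1 = (q - p^-1) / q by field; rewrite p0 q0.
(* The product of the two cancelled factors is a - p^-1 q^-1 a, the difference of the outer nodes in
   [s00E]. *)
apply: (mulrI aU); apply: (@scalerI _ _ (1 - p^-1 * q^-1)).
  by rewrite k0 mulf_neq0 ?invr_neq0.
rewrite scalerAl [X in X * _]scalerBl scale1r.
have -> : (a - (p^-1 * q^-1) *: a) * (L00 - la) = L01 * ga - be * L10.
  apply: (log_cvg_unique _ _ _ _ hA
    (log_cvgMl _ _ _ (log_cvgB _ _ _ _ l00 aln))
    (log_cvgB _ _ _ _ (log_cvgMr ga _ _ l01) (log_cvgMl be _ _ l10))) => n.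
  exact: s00E.
rewrite log_entry01 log_entry10 b1V b2V !invrM //.
rewrite -!scalerAl -!scalerAr -!scalerAl -[(la - lqd) * _ * _]mulrA.
rewrite -[_ * be * ga]mulrA.
rewrite [X in a * X]mulrDl -!scalerAl [(la * _ - _) * _]mulrBl -!mulrA.
rewrite mulrDr -!scalerAr mulrBr.
rewrite (lin_ln_cancel _ _ _ _ _ Vw lin_a aU lin_b1 Uqad lin_a aln).
rewrite (lin_ln_cancel _ _ _ _ _ Vw lin_a aU lin_b2 Upad lin_pqa pqaln).
set b1 := q *: a - d; set b2 := p^-1 *: a - d.
(* Partial fractions: (q - p^-1) a = b1 - b2, so the fraction with denominator b1 b2 splits into one
   over b2 minus one over b1. *)
have e3 : (q - p^-1) *: (a * (lqd * (b1^-1 * (b2^-1 * (be * ga))))) =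
    lqd * (b2^-1 * (be * ga)) - lqd * (b1^-1 * (be * ga)).
  have Vb2 := lin_unit_stab _ lin_b2 Upad _ Vw.
  have Vb12 := lin_unit_stab _ lin_b1 Uqad _ Vb2.
  rewrite scalerAl (comm_on_lin_ln _ _ _ _ lin_qd qdln) //;
    last exact: lin_ada.
  have -> : (q - p^-1) *: a = b1 - b2.
    by rewrite /b1 /b2 opprB addrA subrK scalerBl.
  rewrite mulrBl mulVKr //.
  have -> : b2 * (b1^-1 * (b2^-1 * (be * ga))) = b1^-1 * (be * ga).
    have cb : comm_on A V b2 b1^-1.
      apply: comm_onV => //; first exact: lin_unit_stab.
      exact: comm_on_lin_lin.
    by rewrite cb // mulVKr.
  by rewrite mulrBr.
rewrite scalerDr !scalerA.
(* The factor q - p^-1 is the one consumed by [e3]; every term then carries the common scalar q. *)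
have -> : (1 - p^-1 / q) * q ^+ 2 = q * (q - p^-1) by field; rewrite p0 q0.
rewrite -[(q * (q - p^-1)) *: _]scalerA e3.
have -> : (1 - p^-1 / q) * (q ^+ 2 / (q - p^-1)) = q.
  rewrite k0; field; rewrite q0 p0.
  by rewrite subr_eq0 mulrC pq1.
rewrite scaleNr opprK -!scalerDr !mulrBl; congr (q *: _).
by rewrite addrACA [RHS]addrACA [- (lqd * _) - _]addrC.
Qed.
End Powers.

(** * First row of the logarithm of a matrix, and the symmetry exchanging the rows *)

Section LogEntries.
Context {R : realType} {A : topAlgType R[i]}.

Lemma mx2_00 (a be ga d : A) : mx2 a be ga d 0 0 = a.
Proof. by rewrite mxE. Qed.

Lemma mx2_01 (a be ga d : A) : mx2 a be ga d 0 1 = be.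
Proof. by rewrite mxE. Qed.

Lemma mx2_10 (a be ga d : A) : mx2 a be ga d 1 0 = ga.
Proof. by rewrite mxE. Qed.

Lemma mx2_11 (a be ga d : A) : mx2 a be ga d 1 1 = d.
Proof. by rewrite mxE. Qed.

Definition mx2E := (mx2_00, mx2_01, mx2_10, mx2_11).

Lemma mulmx2E (S T : 'M[A]_2) (i j : 'I_2) :
  (S * T) i j = S i 0 * T 0 j + S i 1 * T 1 j.
Proof.
rewrite mxE !big_ord_recl big_ord0 addr0; congr (_ + S i _ * T _ j);
  exact/val_inj.
Qed.

Lemma GLpq_swap (p q : R[i]) (a be ga d : A) : p != 0 -> q != 0 ->
  GLpq p q (mx2 a be ga d) -> GLpq q p (mx2 d ga be a).
Proof.
move=> p0 q0 [] /[!mx2E] ab db ac dc bc bb cc ad aU dU.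
have bg : be * ga = - (p * q^-1) *: (ga * be).
  by apply/eqP; rewrite scaleNr -addr_eq0 bc.
split; rewrite ?mx2E //.
  have e : q * p^-1 * - (p * q^-1) = -1 by field; rewrite p0 q0.
  by rewrite bg scalerA e scaleN1r subrr.
rewrite -opprB ad bg scalerA -scaleNr; congr (_ *: _).
by field; rewrite p0 q0.
Qed.

(** Only the first row is treated; the second is obtained by applying this to the matrix with rows
    and columns reversed, which [GLpq_swap] places in the family with p and q exchanged. *)
Lemma log_entries (p q : R[i]) (a be ga d : A) (L : 'M[A]_2) :
  hausdorff_space A -> p != 0 -> q != 0 -> p * q != 1 ->
  GLpq p q (mx2 a be ga d) ->
  (forall i j, log_cvg (fun n => ((mx2 a be ga d - 1) ^+ n) i j) (L i j)) ->
  has_ln a -> has_ln (q^-1 *: d) -> has_ln ((p^-1 * q^-1) *: a) ->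
  q *: a - d \is a GRing.unit -> p^-1 *: a - d \is a GRing.unit ->
  L 0 0 = alg_ln a + fun_f q a d p * (be * ga) /\
  L 0 1 = fun_g a (q^-1 *: d) * be.
Proof.
move=> hA p0 q0 pq1 [] /[!mx2E] ab db ac dc bc bb cc ad aU dU Ts.
move=> /alg_lnP aln /alg_lnP qdln /alg_lnP pqaln Uqad Upad.
set T := mx2 a be ga d in Ts.
have X00 : (T - 1) 0 0 = a - 1 by rewrite !mxE.
have X01 : (T - 1) 0 1 = be by rewrite !mxE subr0.
have X10 : (T - 1) 1 0 = ga by rewrite !mxE subr0.
have X11 : (T - 1) 1 1 = d - 1 by rewrite !mxE.
have XS n i j : ((T - 1) ^+ n.+1) i j =
    (T - 1) i 0 * ((T - 1) ^+ n) 0 j + (T - 1) i 1 * ((T - 1) ^+ n) 1 j.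
  by rewrite exprS mulmx2E.
pose s i j n := ((T - 1) ^+ n) i j.
have s00_0 : s 0 0 0%N = 1 by rewrite /s expr0 mxE.
have s01_0 : s 0 1 0%N = 0 by rewrite /s expr0 mxE.
have s10_0 : s 1 0 0%N = 0 by rewrite /s expr0 mxE.
have s11_0 : s 1 1 0%N = 1 by rewrite /s expr0 mxE.
have s00_S n : s 0 0 n.+1 = (a - 1) * s 0 0 n + be * s 1 0 n.
  by rewrite /s XS X00 X01.
have s01_S n : s 0 1 n.+1 = (a - 1) * s 0 1 n + be * s 1 1 n.
  by rewrite /s XS X00 X01.
have s10_S n : s 1 0 n.+1 = ga * s 0 0 n + (d - 1) * s 1 0 n.
  by rewrite /s XS X10 X11.
have s11_S n : s 1 1 n.+1 = ga * s 0 1 n + (d - 1) * s 1 1 n.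
  by rewrite /s XS X10 X11.
split.
  exact: (log_entry00 p0 q0 pq1 ab db ac dc bc bb cc ad s00_0 s01_0 s10_0 s11_0
    s00_S s01_S s10_S s11_S hA (Ts 0 0) (Ts 0 1) (Ts 1 0) aln qdln pqaln aU).
rewrite /fun_g -mulrA.
exact: (log_entry01 p0 q0 ab db ac dc bc bb ad s01_0 s11_0
  s01_S s11_S hA (Ts 0 1) aln qdln Uqad).
Qed.


(** Reversing rows and columns is conjugation by a permutation matrix, hence multiplicative. *)
Lemma mxsub_revX (X : 'M[A]_2) (n : nat) :
  mxsub (@rev_ord 2) (@rev_ord 2) X ^+ n =
  mxsub (@rev_ord 2) (@rev_ord 2) (X ^+ n).
Proof.
elim: n => [|n IHn].
  rewrite !expr0; apply/matrixP => i j; rewrite !mxE.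
  by rewrite (inj_eq rev_ord_inj).
rewrite !exprS IHn; apply/matrixP => i j; rewrite !mxE.
rewrite (reindex_inj rev_ord_inj); apply: eq_bigr => k _.
by rewrite !mxE rev_ordK.
Qed.

Lemma mx2_rev (a be ga d : A) :
  mx2 d ga be a - 1 = mxsub (@rev_ord 2) (@rev_ord 2) (mx2 a be ga d - 1).
Proof.
by apply/matrixP => -[[|[|i]] Hi] -[[|[|j]] Hj] //; rewrite !mxE.
Qed.

End LogEntries.

(** * Non-vanishing of the parameters and the four entries of M *)

Lemma cexp_neq0 (R : realType) (z : R[i]) : cexp z != 0.
Proof.
apply/negP => /eqP [] /eqP + /eqP.
rewrite !mulf_eq0 ![expR _ == 0]gt_eqF ?expR_gt0 //= => /eqP c0 /eqP s0.
have := cos2Dsin2 (complex.Im z).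
by rewrite c0 s0 expr0n addr0 => /esym/eqP; rewrite oner_eq0.
Qed.


Theorem lemma4p1 (R : realType) (A : topAlgType R[i]) (hA : hausdorff_space A)
    (h1 h2 q p h : R[i]) (a be ga d x mu nu y : A)
    (hq : q = cexp h1) (hp : p = cexp h2)
    (hpq : p * q != 1) (hpqN : p * q != -1)
    (hh : h = (h1 + h2) / 2)
    (hT : GLpq p q (mx2 a be ga d))
    (* the logarithmic series make sense *)
    (lnT : has_mx_ln (mx2 a be ga d))
    (lna : has_ln a) (lnd : has_ln d)
    (lnqd : is_ln (q^-1 *: d) (alg_ln d - h1%:A))
    (lnpa : is_ln (p^-1 *: a) (alg_ln a - h2%:A))
    (lnpqa : is_ln ((p^-1 * q^-1) *: a) (alg_ln a - h1%:A - h2%:A))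
    (lnpqd : is_ln ((p^-1 * q^-1) *: d) (alg_ln d - h1%:A - h2%:A))
    (* denominators of f_q, f_p and g *)
    (Uqad : (q *: a - d) \is a GRing.unit)
    (Upad : (p^-1 *: a - d) \is a GRing.unit)
    (Upda : (p *: d - a) \is a GRing.unit)
    (Uqda : (q^-1 *: d - a) \is a GRing.unit)
    (Uaqd : (a - q^-1 *: d) \is a GRing.unit)
    (Udpa : (d - p^-1 *: a) \is a GRing.unit)
    (hM : mx2 x mu nu y = scalemx2 h^-1 (mx_ln (mx2 a be ga d))) :
  [/\ x = h^-1 *: (alg_ln a + fun_f q a d p * (be * ga)),
      mu = h^-1 *: (fun_g a (q^-1 *: d) * be),
      y = h^-1 *: (alg_ln d + fun_f p d a q * (ga * be)) &
      nu = h^-1 *: (fun_g d (p^-1 *: a) * ga)].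
Proof.
have q0 : q != 0 by rewrite hq cexp_neq0.
have p0 : p != 0 by rewrite hp cexp_neq0.
set L := mx_ln (mx2 a be ga d) in hM.
(* Convergence of the matrix series guarantees that [L] is its limit and not merely the default
   value 0. *)
have TL : is_mx_ln (mx2 a be ga d) L by exact: xgetPex.
have TLij i j := mx_log_cvg _ _ i j TL.
have [L00 L01] := log_entries _ _ _ _ _ _ _ hA p0 q0 hpq hT TLij lna
  (ex_intro _ _ lnqd) (ex_intro _ _ lnpqa) Uqad Upad.
(* The series of the reversed matrix converges entrywise to the reversal of [L], so its first row is
   the second row of [L] read backwards. *)
have TL'ij i j : log_cvg (fun n => ((mx2 d ga be a - 1) ^+ n) i j)
    (mxsub (@rev_ord 2) (@rev_ord 2) L i j).
  have -> : (fun n => ((mx2 d ga be a - 1) ^+ n) i j) =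
      (fun n => ((mx2 a be ga d - 1) ^+ n) (rev_ord i) (rev_ord j)).
    by apply/funext => n; rewrite mx2_rev mxsub_revX mxE.
  by rewrite mxE.
have qp1 : q * p != 1 by rewrite mulrC.
rewrite [p^-1 * q^-1]mulrC in lnpqd.
have [] := log_entries _ _ _ _ _ _ _ hA q0 p0 qp1
  (GLpq_swap _ _ _ _ _ _ p0 q0 hT) TL'ij lnd
  (ex_intro _ _ lnpa) (ex_intro _ _ lnpqd) Upda Uqda.
have r0 : rev_ord 0 = 1 :> 'I_2 by exact/val_inj.
have r1 : rev_ord 1 = 0 :> 'I_2 by exact/val_inj.
rewrite !mxE r0 r1 => L11 L10.
have M i j : mx2 x mu nu y i j = h^-1 *: L i j by rewrite hM mxE.
rewrite -L00 -L01 -L11 -L10 -!M.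
by split; rewrite mxE.
Qed.
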